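(* Let $n\ge 1$, let $m=\lceil n/2\rceil$, and let $x,k_1,\ldots,k_m$ be integers with $k_1<k_2<\cdots<k_m\le x$. Then the number of halved monotone triangles with $n$ rows, bottom row $(k_1,\ldots,k_m)$ and no entry exceeding $x$ is equal to $$\left(\prod_{1\le p<q\le (n+1)/2} E_{k_p}\,(E^{-1}_{k_p}+E^{-1}_{k_q}-\mathrm{id})\,(E^{-1}_{k_p}+E_{k_q}-\mathrm{id})\right)\prod_{1\le i<j\le (n+1)/2}\frac{(k_j-k_i)(2x+1-k_i-k_j)}{(j-i)(j+i-1)}$$ if $n$ is odd, and to $$\left(\prod_{1\le p<q\le n/2} E_{k_p}\,(E^{-1}_{k_p}+E^{-1}_{k_q}-\mathrm{id})\,(E^{-1}_{k_p}+E_{k_q}-\mathrm{id})\right)\prod_{1\le i<j\le n/2}\frac{(k_j-k_i)(2x+2-k_i-k_j)}{(j-i)(j+i)}\prod_{i=1}^{n/2}\frac{x+1-k_i}{i}$$ if $n$ is even.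
   Context: A halved monotone triangle with $n$ rows is a triangular array of integers $(a_{i,j})_{1\le i\le n,\,1\le j\le\lceil i/2\rceil}$ such that $a_{i+1,j}\le a_{i,j}$, $a_{i,j}\le a_{i+1,j+1}$ and $a_{i,j}<a_{i,j+1}$ whenever the entries involved are defined; its bottom row is $(a_{n,1},\ldots,a_{n,\lceil n/2\rceil})$. $E_y$ denotes the shift operator $E_y p(y)=p(y+1)$ acting on polynomials (here in the variables $k_1,\ldots,k_m$, with $x$ treated as a parameter), $E_y^{-1}p(y)=p(y-1)$, and $\mathrm{id}$ is the identity. A product of operators means their composition (the shift operators in different variables commute). The operator is applied to the displayed polynomial in $k_1,\ldots,k_m$ and the result is evaluated at the given integers. *)

(* Defs.v *)
From mathcomp Require Import all_boot all_order all_algebra.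
From mathcomp Require Import finmap.
From mathcomp.multinomials Require Import mpoly.
Set Implicit Arguments.
Unset Strict Implicit.
Unset Printing Implicit Defensive.
Import Order.TTheory GRing.Theory Num.Theory.
Local Open Scope ring_scope.

(* All indices are shifted by one: the 1-based entry a_{i+1,j+1} sits in the
   cell of row i < n and column j < uphalf i.+1 = ceil((i+1)/2). *)
Definition cell (n : nat) : finType := {i : 'I_n & 'I_(uphalf i.+1)}.
Definition row_of n (c : cell n) : nat := tag c.
Definition col_of n (c : cell n) : nat := tagged c.

Definition tri_array (n : nat) : choiceType := {ffun cell n -> int}.

(* Quantifying over pairs of cells in the required relative position renders
   "whenever the entries involved are defined". *)
Definition halved_monotone n (a : tri_array n) : Prop :=
  forall s t : cell n,
  [/\ row_of t = (row_of s).+1 -> col_of t = col_of s -> a t <= a s,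
      row_of t = (row_of s).+1 -> col_of t = (col_of s).+1 -> a s <= a t
    & row_of t = row_of s -> col_of t = (col_of s).+1 -> a s < a t].

Definition has_bottom_row n (a : tri_array n) (k : 'I_(uphalf n) -> int) : Prop :=
  forall (c : cell n) (j : 'I_(uphalf n)),
    (row_of c).+1 = n -> col_of c = j -> a c = k j.

Definition entries_le n (a : tri_array n) (x : int) : Prop :=
  forall c : cell n, a c <= x.

Section Operators.
Variable m : nat.
Local Notation P := {mpoly rat[m]}.

(* shift c i is p(k_1, .., k_m) |-> p(k_1, .., k_i + c, .., k_m) *)
Definition shift (c : rat) (i : 'I_m) (p : P) : P :=
  p \mPo [tuple 'X_j + (if j == i then c else 0)%:MP | j < m].

Definition E (i : 'I_m) : P -> P := shift 1 i.
Definition Einv (i : 'I_m) : P -> P := shift (-1) i.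

Definition pair_op (p q : 'I_m) : P -> P :=
  E p \o (Einv p \+ Einv q \- id) \o (Einv p \+ E q \- id).

Definition triangle_op : P -> P :=
  \big[(fun f g : P -> P => f \o g)/id]_(p < m)
    \big[(fun f g : P -> P => f \o g)/id]_(q < m | (p < q)%N) pair_op p q.

(* With 0-based i and j, the 1-based j + i - 1, j + i and i become
   j + i + 1, j + i + 2 and i + 1. *)
Definition odd_product (x : int) : P :=
  \prod_(i < m) \prod_(j < m | (i < j)%N)
    (((j%:R - i%:R) * (j + i + 1)%:R)^-1 *:
      (('X_j - 'X_i) * ((2 * x + 1)%:~R%:MP - 'X_i - 'X_j))).

Definition even_product (x : int) : P :=
  (\prod_(i < m) \prod_(j < m | (i < j)%N)
    (((j%:R - i%:R) * (j + i + 2)%:R)^-1 *: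
      (('X_j - 'X_i) * ((2 * x + 2)%:~R%:MP - 'X_i - 'X_j)))) *
  \prod_(i < m) ((i + 1)%:R^-1 *: ((x + 1)%:~R%:MP - 'X_i)).

End Operators.

(* Main.v *)
Require Import Defs.
From mathcomp Require Import all_boot all_order all_algebra.
From mathcomp Require Import finmap zify ring lra perm.
From mathcomp.multinomials Require Import mpoly.
From Stdlib Require Import FunctionalExtensionality.
Import Order.TTheory GRing.Theory Num.Theory.
Local Open Scope ring_scope.

(** Write Omega_m for the operator of the theorem, acting on functions of
    k_1, .., k_m, and z = x + 1 - k. Omega is applied to
    det(e_c(k_i)) (n odd) or det(o_c(k_i)) (n even), where, up to the sign
    (-1)^c, e_c = C(z+c-1, 2c) (even_fun) and o_c = C(z+c, 2c+1) (odd_fun);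
    Pascal's rule makes each family a discrete antiderivative of the other.

    Peeling off the bottom row expresses the count as a sum over the strictly
    increasing rows l interlacing with k. Let F be an antiderivative, in every
    variable, of the summand. The inclusion-exclusion enforcing l_i < l_(i+1)
    applies W = E_s E_t + id - E_t (s, t adjacent) to F on the diagonal; for
    F = Omega(antisymmetric function) this vanishes, because W times the factor
    of Omega indexed by (s, t) is symmetric in s and t. What survives is
      sum_j (-1)^j F(k_0, .., k_(j-1), k_(j+1) + 1, .., k_M + 1).
    On functions not depending on k_j, Omega_m reduces to Omega_(m-1) followed by
    the shifts E_p^-1, p < j, so for n odd the surviving sum is the expansion of
    det(e_c(k_i)) along its constant column e_0. For n even the last upper bound
    is k_M = x, and o_c is odd about x + 1 while Omega is invariant under
    inverting the last shift, so that only the term j = M is nonzero. *)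

(** * The pair operators on functions of integer points *)

(** Points have infinitely many coordinates, so that deleting or prepending one stays in the same
    type; [local m] records that only the first m matter. *)
Definition point := nat -> int.
Definition pfun := point -> rat.

Definition sh (i : nat) (c : int) (k : point) : point :=
  fun j => if j == i then k j + c else k j.

Lemma shC i c j d k : sh i c (sh j d k) = sh j d (sh i c k).
Proof.
apply: functional_extensionality => l; rewrite /sh.
by case: eqP; case: eqP => // _ _; rewrite addrAC.
Qed.

Lemma shD i c d k : sh i c (sh i d k) = sh i (d + c) k.
Proof.
by apply: functional_extensionality => l; rewrite /sh; case: eqP; rewrite ?addrA.
Qed.

Lemma sh0 i k : sh i 0 k = k.
Proof. by apply: functional_extensionality => l; rewrite /sh addr0 if_same. Qed.

Definition translate (d k : point) : point := fun i => k i + d i.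

Lemma sh_translate i c d k : sh i c (translate d k) = translate d (sh i c k).
Proof.
by apply: functional_extensionality => l; rewrite /sh /translate; case: eqP; rewrite // addrAC.
Qed.

(* The coefficients of E_p (E_p^-1 + E_q^-1 - id) (E_p^-1 + E_q - id). *)
Definition pair_sum (g : int -> int -> rat) : rat :=
  g (-1) 0 + g 0 1 + g 0 (-1) + 2 * g 1 0 - 2 * g 0 0 - g 1 (-1) - g 1 1.

Definition pair_fun (p q : nat) (f : pfun) : pfun :=
  fun k => pair_sum (fun a b => f (sh p a (sh q b k))).

Definition pair_ops (L : seq (nat * nat)) (f : pfun) : pfun :=
  foldr (fun pq => pair_fun pq.1 pq.2) f L.

Lemma pair_funC p q r s f : pair_fun p q (pair_fun r s f) = pair_fun r s (pair_fun p q f).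
Proof.
apply: functional_extensionality => k.
rewrite /pair_fun; set h := fun a b c d => f (sh r c (sh s d (sh p a (sh q b k)))).
transitivity (pair_sum (fun a b => pair_sum (h a b))); first by [].
transitivity (pair_sum (fun c d => pair_sum (fun a b => h a b c d))).
  by rewrite /pair_sum; ring.
have E a b c d : h a b c d = f (sh p a (sh q b (sh r c (sh s d k)))).
  by rewrite /h (shC s) (shC r c p) (shC s d q) (shC r c q).
by rewrite /pair_sum !E.
Qed.

Lemma pair_ops_cat L1 L2 f : pair_ops (L1 ++ L2) f = pair_ops L1 (pair_ops L2 f).
Proof. exact: foldr_cat. Qed.

Lemma pair_fun_ops p q L f : pair_fun p q (pair_ops L f) = pair_ops L (pair_fun p q f).
Proof. by elim: L => //= a L <-; rewrite pair_funC. Qed.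

Lemma pair_opsC L1 L2 f : pair_ops L1 (pair_ops L2 f) = pair_ops L2 (pair_ops L1 f).
Proof. by elim: L1 => //= a L ->; rewrite pair_fun_ops. Qed.

Lemma pair_ops_perm L1 L2 f : perm_eq L1 L2 -> pair_ops L1 f = pair_ops L2 f.
Proof.
by apply: (catCA_perm_subst (F := fun L => pair_ops L f)) => a b c; rewrite !pair_ops_cat pair_opsC.
Qed.

Lemma pair_ops_translate L f d k : pair_ops L (f \o translate d) k = pair_ops L f (translate d k).
Proof.
by elim: L k => //= a L IH k; rewrite /pair_fun /pair_sum !IH !sh_translate.
Qed.

Definition lcomb (a b : rat) (f g : pfun) : pfun := fun k => a * f k + b * g k.

Definition scal (a : rat) (f : pfun) : pfun := fun k => a * f k.

Lemma pair_ops_scal L a f : pair_ops L (scal a f) = scal a (pair_ops L f).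
Proof.
elim: L => //= pq L ->; apply: functional_extensionality => k.
by rewrite /pair_fun /pair_sum /scal; ring.
Qed.

Lemma pair_ops_sum n L (F : nat -> pfun) k :
  pair_ops L (fun k => \sum_(i < n) F i k) k = \sum_(i < n) pair_ops L (F i) k.
Proof.
elim: L k => //= pq L IH k; rewrite {1}/pair_fun /pair_sum !IH.
by rewrite -!sumrN !mulr_sumr -!sumrN -!big_split; apply: eq_bigr.
Qed.

Definition local m (f : pfun) := forall k k' : point,
  (forall i, (i < m)%N -> k i = k' i) -> f k = f k'.

Lemma pair_ops_local m L f : local m f -> local m (pair_ops L f).
Proof.
move=> lf; elim: L => //= pq L IH k k' kk'; rewrite /pair_fun /pair_sum.
have E a b : pair_ops L f (sh pq.1 a (sh pq.2 b k)) = pair_ops L f (sh pq.1 a (sh pq.2 b k')).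
  by apply: IH => i im; rewrite /sh (kk' i im).
by rewrite !E.
Qed.

Definition pairs m : seq (nat * nat) :=
  [seq (p, q) | p <- iota 0 m, q <- [seq q <- iota 0 m | (p < q)%N]].

Lemma mem_pairs m p q : ((p, q) \in pairs m) = ((p < q) && (q < m))%N.
Proof.
apply/allpairsPdep/idP => [[p' [q' [+ + [-> ->]]]]|/andP[pq qm]].
  by rewrite mem_filter !mem_iota /= add0n => _ /andP[-> ->].
by exists p, q; rewrite mem_filter !mem_iota /= add0n pq qm (ltn_trans pq qm).
Qed.

Lemma uniq_pairs m : uniq (pairs m).
Proof.
apply: allpairs_uniq_dep; first exact: iota_uniq.
  by move=> p _; rewrite filter_uniq ?iota_uniq.
by move=> [a b] [c d] _ _ /= [-> ->].
Qed.

Definition omega m := pair_ops (pairs m).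

(** * Exchanging two adjacent variables *)

Definition swap_next (s i : nat) : nat := if i == s then s.+1 else if i == s.+1 then s else i.

Lemma swK s : involutive (swap_next s).
Proof. by move=> i; rewrite /swap_next; do !case: eqP; lia. Qed.

Lemma sh_sw s i c (k : point) : sh i c (k \o swap_next s) = sh (swap_next s i) c k \o swap_next s.
Proof.
apply: functional_extensionality => l; rewrite /sh /=.
by rewrite (inj_eq (can_inj (swK s))).
Qed.

Definition swpair s (pq : nat * nat) := (swap_next s pq.1, swap_next s pq.2).

Lemma pair_ops_sw s L f k : pair_ops L f (k \o swap_next s) =
  pair_ops (map (swpair s) L) (fun k => f (k \o swap_next s)) k.
Proof.
by elim: L k => //= a L IH k; rewrite /pair_fun /pair_sum !sh_sw !IH.
Qed.

(** An adjacent transposition reverses the order of the single pair (s, s+1); every other increasing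
    pair goes to an increasing pair. *)
Lemma pairs_sw s m : (s.+1 < m)%N ->
  perm_eq (map (swpair s) (rem (s, s.+1) (pairs m))) (rem (s, s.+1) (pairs m)).
Proof.
move=> sm; have swpK : involutive (swpair s) by move=> [p q]; rewrite /swpair /= !swK.
have un : uniq (rem (s, s.+1) (pairs m)) by rewrite rem_uniq ?uniq_pairs.
apply: uniq_perm => //; first by rewrite map_inj_uniq //; exact: can_inj swpK.
have M pq : (swpair s pq \in rem (s, s.+1) (pairs m)) = (pq \in rem (s, s.+1) (pairs m)).
  case: pq => p q; rewrite !mem_rem_uniq ?uniq_pairs //.
  rewrite !inE !mem_pairs /swpair /swap_next /= !xpair_eqE.
  by do !case: eqP; lia.
move=> pq; apply/mapP/idP => [[rs + ->]|H]; first by rewrite M.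
by exists (swpair s pq); rewrite ?M ?swpK.
Qed.

(** The W of the overview, with t = s + 1. Summing the mixed difference of f over l_s <= c <= l_t
    and removing the term l_s = l_t = c leaves minus this expression at the corner (c, c): the
    values f(c + 1, c) cancel. *)
Definition strict_fun s (f : pfun) : pfun :=
  fun k => f (sh s 1 (sh s.+1 1 k)) + f k - f (sh s.+1 1 k).

Lemma pair_ops_strict s L f : pair_ops L (strict_fun s f) = strict_fun s (pair_ops L f).
Proof.
elim: L => //= pq L ->; apply: functional_extensionality => k.
rewrite /pair_fun /strict_fun /pair_sum !(shC _ _ s) !(shC _ _ s.+1); ring.
Qed.

Definition antisym m (f : pfun) := forall s k, (s.+1 < m)%N -> f (k \o swap_next s) = - f k.

(* pair_fun s s.+1 and strict_fun s are asymmetric in s and s.+1, but their product is symmetric. *)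
Lemma strict_pair_fun_sw s f k : f \o (fun k => k \o swap_next s) =1 (fun k => - f k) ->
  strict_fun s (pair_fun s s.+1 f) (k \o swap_next s) = - strict_fun s (pair_fun s s.+1 f) k.
Proof.
move=> as_f; have swL : swap_next s s = s.+1 by rewrite /swap_next eqxx.
have swR : swap_next s s.+1 = s by rewrite -{1}swL swK.
rewrite /strict_fun /pair_fun /pair_sum !sh_sw swL swR.
have E k' : f (k' \o swap_next s) = - f k' := as_f k'.
rewrite !E !(shC s.+1 _ s) !shD.
rewrite /=; ring.
Qed.

(** Once the factor (s, s+1) is split off, the swap permutes the remaining factors, and W times that
    factor keeps f antisymmetric. At a point fixed by the swap the value is its own negative. *)
Lemma omega_vanish m f s k : antisym m f -> (s.+1 < m)%N -> k s = k s.+1 ->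
  strict_fun s (omega m f) k = 0.
Proof.
move=> as_f sm eq_k.
have ss : (s, s.+1) \in pairs m by rewrite mem_pairs leqnn.
rewrite /omega (pair_ops_perm _ _ f (perm_to_rem ss)) /=.
set L := rem _ _; rewrite pair_fun_ops -pair_ops_strict.
set h := strict_fun s _.
have hsw : (fun k => h (k \o swap_next s)) = scal (-1) h.
  apply: functional_extensionality => k'.
  rewrite /scal mulN1r /h; apply: strict_pair_fun_sw => k''; exact: as_f.
have kk : k \o swap_next s = k.
  apply: functional_extensionality => i; rewrite /swap_next /=.
  by case: eqP => [->|_] //; case: eqP => [->|].
have := pair_ops_sw s L h k; rewrite kk hsw pair_ops_scal.
rewrite (pair_ops_perm _ _ h (pairs_sw s m sm)) -/L /scal.
by lra.
Qed.

(** * Reflecting the last variable *)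

Definition refl (q : nat) (c : int) (k : point) : point :=
  fun i => if i == q then c - k i else k i.

Lemma sh_refl i a q c k : sh i a (refl q c k) = refl q c (sh i (if i == q then - a else a) k).
Proof.
apply: functional_extensionality => l; rewrite /sh /refl.
by case: (eqVneq i q) => [->|]; do !case: eqP => //; lia.
Qed.

(** [pair_sum] weighs b and -b equally, but not a and -a; hence q is kept from being the first index
    of a pair. *)
Lemma pair_ops_refl q c L f k : all (fun pq => pq.1 != q) L ->
  pair_ops L f (refl q c k) = pair_ops L (fun k => f (refl q c k)) k.
Proof.
elim: L k => //= -[a b] L IH k /andP[/negbTE aq /IH{}IH].
rewrite /pair_fun /pair_sum /= !sh_refl aq !IH.
case: eqP => _ //; rewrite oppr0 opprK; ring.
Qed.

(** The largest index m is never the first of a pair, and k is a fixed point of the reflection. *)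
Lemma omega_odd m f c k : (forall k, f (refl m c k) = - f k) -> k m + k m = c ->
  omega m.+1 f k = 0.
Proof.
move=> odd_f kc.
have fr : (fun k => f (refl m c k)) = scal (-1) f.
  by apply: functional_extensionality => k'; rewrite odd_f /scal mulN1r.
have kr : refl m c k = k.
  by apply: functional_extensionality => i; rewrite /refl; case: eqP => // ->; lia.
have := pair_ops_refl m c (pairs m.+1) f k; rewrite kr fr pair_ops_scal /scal /omega => H.
suff: all (fun pq : nat * nat => pq.1 != m) (pairs m.+1) by move=> /H; lra.
by apply/allP => -[p q]; rewrite mem_pairs /=; lia.
Qed.

(** * Functions that do not depend on one variable *)

Definition del (j : nat) (k : point) : point := fun i => k (bump j i).

Lemma bump_inj j : injective (bump j).
Proof. exact: can_inj (bumpK j). Qed.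

Lemma sh_del j i c k : del j (sh (bump j i) c k) = sh i c (del j k).
Proof.
by apply: functional_extensionality => l; rewrite /sh /del (inj_eq (bump_inj j)).
Qed.

Lemma sh_del_id j c k : del j (sh j c k) = del j k.
Proof.
by apply: functional_extensionality => l; rewrite /sh /del eq_sym (negbTE (neq_bump j l)).
Qed.

Lemma pair_ops_del j L f : pair_ops [seq (bump j pq.1, bump j pq.2) | pq <- L] (f \o del j) =
  pair_ops L f \o del j.
Proof.
elim: L => //= pq L ->; apply: functional_extensionality => k.
by rewrite /pair_fun /pair_sum /= !sh_del.
Qed.

(** If f ignores the first variable of a pair, the weights of [pair_sum] collapse to the
    identity. *)
Lemma pair_ops_del_right j s f : all (fun q => (j <= q)%N) s ->
  pair_ops [seq (j, q.+1) | q <- s] (f \o del j) = f \o del j.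
Proof.
elim: s => //= q s IH /andP[jq /IH->]; apply: functional_extensionality => k.
have <- : bump j q = q.+1 by rewrite /bump jq.
by rewrite /pair_fun /pair_sum /= !sh_del_id !sh_del !sh0; ring.
Qed.

Definition lower (s : seq nat) : point -> point := translate (fun i => if i \in s then -1 else 0).

(** If f ignores the second variable of a pair, the weights collapse to the single shift E_p^-1. *)
Lemma pair_ops_del_left j s f : all (fun p => (p < j)%N) s -> uniq s ->
  pair_ops [seq (p, j) | p <- s] (f \o del j) = f \o lower s \o del j.
Proof.
elim: s => /= [_ _|p s IH /andP[pj /IH{}IH] /andP[ps /IH->]].
  apply: functional_extensionality => k /=; congr f.
  by apply: functional_extensionality => i; rewrite /lower /translate addr0.
apply: functional_extensionality => k.
have bp : bump j p = p by rewrite /bump leqNgt pj.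
have E c k' : del j (sh p c k') = sh p c (del j k') by rewrite -{1}bp sh_del.
rewrite /pair_fun /pair_sum /= !E !sh_del_id.
have -> : lower (p :: s) (del j k) = lower s (sh p (-1) (del j k)).
  apply: functional_extensionality => i; rewrite /lower /translate /sh inE.
  by case: (eqVneq i p) => [->|] //=; rewrite (negbTE ps) addr0.
rewrite !sh0; ring.
Qed.

(** [omega_del] needs the pairs sorted by the position of j, since each class acts differently on a
    function that ignores the variable j. *)
Lemma pairs_bump m j : (j <= m)%N ->
  perm_eq (pairs m.+1)
    ([seq (bump j pq.1, bump j pq.2) | pq <- pairs m] ++
     [seq (j, q.+1) | q <- iota j (m - j)] ++ [seq (p, j) | p <- iota 0 j]).
Proof.
move=> jm; apply: uniq_perm; first exact: uniq_pairs.
  rewrite !cat_uniq !map_inj_uniq ?iota_uniq ?uniq_pairs //; first last.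
  - by move=> [a b] [c d] /= [/(bump_inj j) -> /(bump_inj j) ->].
  - by move=> a b [].
  - by move=> a b [].
  rewrite /= andbT; apply/andP; split; apply/hasPn => -[p q].
  - rewrite mem_cat; apply: contraTN => /mapP[[a b] _ /= [-> ->]].
    rewrite negb_or; apply/andP; split; apply/mapP => -[r _ []].
    + by move=> /eqP; rewrite eq_sym (negbTE (neq_bump _ _)).
    + by move=> _ /eqP; rewrite eq_sym (negbTE (neq_bump _ _)).
  - move=> /mapP[r + [-> ->]]; rewrite mem_iota => rj.
    by apply/mapP => -[t _ []]; lia.
move=> [p q]; rewrite mem_pairs !mem_cat; apply/idP/idP => [pq|].
  case: (eqVneq p j) => [pj|pj].
    apply/orP; right; apply/orP; left; apply/mapP; exists q.-1; last by congr pair; lia.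
    by rewrite mem_iota; lia.
  case: (eqVneq q j) => [qj|qj].
    apply/orP; right; apply/orP; right; apply/mapP; exists p; last by rewrite qj.
    by rewrite mem_iota; lia.
  apply/orP; left; apply/mapP; exists (unbump j p, unbump j q).
    by rewrite mem_pairs /unbump; lia.
  by rewrite /= !unbumpK.
case/orP => [/mapP[[a b] + [-> ->]]|/orP[/mapP[r + [-> ->]]|/mapP[r + [-> ->]]]].
- by rewrite mem_pairs /= /bump; lia.
- by rewrite mem_iota; lia.
- by rewrite mem_iota; lia.
Qed.

Lemma omega_del m j f : (j <= m)%N ->
  omega m.+1 (f \o del j) = omega m f \o lower (iota 0 j) \o del j.
Proof.
move=> jm; rewrite /omega (pair_ops_perm _ _ _ (pairs_bump m j jm)) !pair_ops_cat.
rewrite pair_ops_del_left ?iota_uniq //; last by apply/allP => p; rewrite mem_iota.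
rewrite pair_ops_del_right; last by apply/allP => q; rewrite mem_iota => /andP[].
rewrite pair_ops_del; apply: functional_extensionality => k /=; exact: pair_ops_translate.
Qed.

(** * From polynomials to functions of integer points *)

Definition eval_int m (p : {mpoly rat[m]}) : pfun := fun K => p.@[fun i : 'I_m => (K i)%:~R].

Lemma eval_int_shift m (c : int) (i : 'I_m) p K : eval_int m (shift c%:~R i p) K =
  eval_int m p (sh i c K).
Proof.
rewrite /eval_int /shift comp_mpoly_meval; apply: meval_eq => j.
rewrite tnth_mktuple mevalD mevalXU mevalC /sh.
by rewrite -(inj_eq val_inj); case: eqP => _; rewrite ?addr0 // intrD.
Qed.

Lemma eval_int_pair_op m (p q : 'I_m) f : eval_int m (pair_op p q f) = pair_fun p q (eval_int m f).
Proof.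
apply: functional_extensionality => K.
have E1 i g K' : eval_int m (E i g) K' = eval_int m g (sh i 1 K') by exact: (eval_int_shift _ 1).
have E2 i g K' : eval_int m (Einv i g) K' = eval_int m g (sh i (-1) K')
  by exact: (eval_int_shift _ (-1)).
have ED g h K' : eval_int m (g + h) K' = eval_int m g K' + eval_int m h K' by exact: mevalD.
have EB g h K' : eval_int m (g - h) K' = eval_int m g K' - eval_int m h K' by exact: mevalB.
rewrite /pair_op /= E1 /GRing.add_fun /GRing.sub_fun /= !(EB, ED, E2, E1).
by rewrite /pair_fun /pair_sum !(shC q _ p) !shD !sh0 /=; ring.
Qed.

Lemma eval_int_triangle_op m f : eval_int m (triangle_op f) = omega m (eval_int m f).
Proof.
have enumE : map val (index_enum 'I_m) = iota 0 m.
  by rewrite [index_enum _]unlock -enumT val_enum_ord.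
have inner (p : 'I_m) (r : seq 'I_m) g :
  eval_int m ((\big[(fun f g => f \o g)/id]_(q <- r | (p < q)%N) pair_op p q) g) =
  pair_ops [seq (val p, q) | q <- [seq q <- map val r | (p < q)%N]] (eval_int m g).
  elim: r g => [|q r IH] g; first by rewrite big_nil.
  rewrite big_cons /=; case: ifP => //= _.
  by rewrite eval_int_pair_op IH.
have outer (r : seq 'I_m) g :
  eval_int m ((\big[(fun f g => f \o g)/id]_(p <- r)
    \big[(fun f g => f \o g)/id]_(q < m | (p < q)%N) pair_op p q) g) =
  pair_ops [seq (p, q) | p <- map val r, q <- [seq q <- iota 0 m | (p < q)%N]] (eval_int m g).
  elim: r g => [|p r IH] g; first by rewrite big_nil.
  by rewrite big_cons /= inner IH pair_ops_cat enumE.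
by rewrite /triangle_op outer enumE.
Qed.

(** * Summation over interlacing rows *)

Definition pcons (l : int) (k : point) : point := fun i => if i is i'.+1 then k i' else l.
Definition ptail (k : point) : point := fun i => k i.+1.
Definition pad (s : seq int) : point := nth 0 s.
Definition pzero : point := fun=> 0.

Lemma pad_nil : pad [::] = pzero.
Proof. by apply: functional_extensionality => i; rewrite /pad nth_nil. Qed.

Lemma pad_cons l s : pad (l :: s) = pcons l (pad s).
Proof. by apply: functional_extensionality => -[|i]. Qed.

Lemma sh_pconsS i c l k : pcons l (sh i c k) = sh i.+1 c (pcons l k).
Proof. by apply: functional_extensionality => -[|j]. Qed.

Lemma sh_pcons0 c l k : sh 0 c (pcons l k) = pcons (l + c) k.
Proof. by apply: functional_extensionality => -[|j]. Qed.

Definition irange (lo hi : int) : seq int :=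
  [seq lo + i%:Z | i <- iota 0 (if (hi + 1 - lo)%R is Posz n then n else 0%N)].

Lemma mem_irange lo hi l : (l \in irange lo hi) = (lo <= l <= hi).
Proof.
apply/mapP/idP => [[i + ->]|H]; first by rewrite mem_iota; case E : (hi + 1 - lo) => [n|n]; lia.
exists (absz (l - lo)%R); last by lia.
by rewrite mem_iota; case E : (hi + 1 - lo) => [n|n]; lia.
Qed.

Lemma uniq_irange lo hi : uniq (irange lo hi).
Proof. by rewrite map_inj_uniq ?iota_uniq // => i j; lia. Qed.

Lemma irange_rcons (lo hi : int) : lo <= hi -> irange lo hi = rcons (irange lo (hi - 1)) hi.
Proof.
move=> le; rewrite /irange; have [n ->] : exists n, hi = lo + Posz n.
  by exists (absz (hi - lo)%R); lia.
have -> : lo + n%:Z + 1 - lo = Posz n.+1 by lia.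
have -> : lo + n%:Z - 1 + 1 - lo = Posz n by lia.
by rewrite -addn1 iotaD map_cat cats1.
Qed.

(** The empty range lo = hi + 1 is included: it occurs for the last coordinate of a row and after
    the top value of a range is split off. *)
Lemma irange_telescope (lo hi : int) (g : int -> rat) : lo <= hi + 1 ->
  \sum_(l <- irange lo hi) (g (l + 1) - g l) = g (hi + 1) - g lo.
Proof.
move=> le; have [n Dn] : exists n, hi = lo + Posz n - 1.
  by exists (absz (hi + 1 - lo)%R); lia.
rewrite {}Dn {le hi} subrK; elim: n => [|n IH].
  rewrite /irange; have -> : lo + 0%:Z - 1 + 1 - lo = 0%N by lia.
  by rewrite big_nil addr0 subrr.
rewrite irange_rcons; last by lia.
have -> : lo + n.+1%:Z - 1 = lo + n%:Z by lia.
rewrite -cats1 big_cat big_seq1 /= IH.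
have -> : lo + n%:Z + 1 = lo + n.+1%:Z by lia.
ring.
Qed.

(* Rows r with lo <= r_0 <= k_0 <= r_1 <= k_1 <= ..., strictly increasing. Strictness is
   encoded by raising the next lower bound to k_0 + 1 as soon as r_0 = k_0. *)
Fixpoint rows (M : nat) (lo : int) (k : point) : seq (seq int) :=
  if M is M'.+1 then
    [seq l :: r | l <- irange lo (k 0%N),
                  r <- rows M' (if l == k 0%N then k 0%N + 1 else k 0%N) (ptail k)]
  else [:: [::]].

Lemma uniq_rows M lo k : uniq (rows M lo k).
Proof.
elim: M lo k => //= M IH lo k; apply: allpairs_uniq_dep; first exact: uniq_irange.
  by move=> *; exact: IH.
by move=> [a b] [c d] _ _ /= [-> ->].
Qed.

(** Since r_0 <= k_0 <= r_1, strictness can fail only when both entries equal k_0, which is what the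
    raised lower bound excludes. *)
Lemma mem_rows M lo k r : reflect
  [/\ size r = M, forall i, (i < M)%N -> pcons lo k i <= r`_i <= k i
    & forall i, (i.+1 < M)%N -> r`_i < r`_i.+1]
  (r \in rows M lo k).
Proof.
elim: M lo k r => [|M IH] lo k r /=.
  rewrite inE; apply: (iffP eqP) => [-> //|[/size0nil]//].
apply: (iffP allpairsPdep) => [[l [s [+ /IH[sz bd inc] ->]]]|].
  rewrite mem_irange => lb; split => [|[|i] iM|[|i] iM] /=; rewrite ?sz //.
  - move: (bd i iM); case: i {iM} => [|i] //=; rewrite /ptail; case: eqP; lia.
  - have /= := bd 0%N iM; case: eqP; lia.
  - exact: inc.
case: r => [|l s] [] // [sz] bd inc; exists l, s; split => //.
  by rewrite mem_irange; exact: (bd 0%N).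
apply/IH; split => // i iM; last exact: (inc i.+1).
move: (bd i.+1 iM) (inc 0%N); case: i iM => [|i] iM //=.
by rewrite /ptail => b1 /(_ iM) b2; case: eqP; lia.
Qed.

Definition row_sum M lo k (f : pfun) : rat := \sum_(r <- rows M lo k) f (pad r).

Lemma row_sumS M lo k f :
  row_sum M.+1 lo k f = \sum_(l <- irange lo (k 0%N))
    row_sum M (if l == k 0%N then k 0%N + 1 else k 0%N) (ptail k) (fun k' => f (pcons l k')).
Proof.
rewrite /row_sum /= big_allpairs_dep /=; apply: eq_bigr => l _; apply: eq_bigr => r _.
by rewrite pad_cons.
Qed.

Lemma row_sum0 lo k f : row_sum 0 lo k f = f pzero.
Proof. by rewrite /row_sum big_seq1 pad_nil. Qed.

(** * Finite differences and their boundary terms *)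

Definition dif (i : nat) (f : pfun) : pfun := fun k => f (sh i 1 k) - f k.
Definition difs (s : seq nat) (f : pfun) : pfun := foldr dif f s.

Lemma difsB s f g : difs s (fun k => f k - g k) = fun k => difs s f k - difs s g k.
Proof.
elim: s => //= i s ->; apply: functional_extensionality => k; rewrite /dif; ring.
Qed.

Lemma difs_pcons s f l : (fun k => difs (map S s) f (pcons l k)) = difs s (fun k => f (pcons l k)).
Proof.
elim: s => //= i s <-; apply: functional_extensionality => k.
by rewrite /dif sh_pconsS.
Qed.

Lemma difs_iotaS M f l :
  (fun k => difs (iota 0 M.+1) f (pcons l k)) =
  difs (iota 0 M) (fun k => f (pcons (l + 1) k) - f (pcons l k)).
Proof.
have -> : iota 0 M.+1 = 0%N :: map S (iota 0 M) by rewrite -(iotaDl 1 0).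
rewrite difsB -!difs_pcons.
by apply: functional_extensionality => k; rewrite /= /dif sh_pcons0.
Qed.

Lemma pair_ops_difs L s f : pair_ops L (difs s f) = difs s (pair_ops L f).
Proof.
have E i g : pair_ops L (dif i g) = dif i (pair_ops L g).
  elim: L => //= pq L ->; apply: functional_extensionality => k.
  rewrite /pair_fun /dif /pair_sum !(shC _ _ i); ring.
by elim: s => //= i s <-; rewrite E.
Qed.

(** The value 0 from M on matches the padding of rows by [pad] and [pzero]. *)
Definition up M (k : point) : point := fun i => if (i < M)%N then k i + 1 else 0.

Fixpoint boundary_sum (M : nat) (lo : int) (k : point) (G : pfun) : rat :=
  if M is M'.+1 then
    G (up M k) - boundary_sum M' (k 0%N) (ptail k) (fun l => G (pcons lo l))
  else G pzero.

Lemma boundary_sum_lcomb M lo k a b G H :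
  boundary_sum M lo k (lcomb a b G H) = a * boundary_sum M lo k G + b * boundary_sum M lo k H.
Proof.
elim: M lo k G H => //= M IH lo k G H.
rewrite -[fun l => lcomb _ _ _ _ _]/(lcomb a b (fun l => G (pcons lo l)) (fun l => H (pcons lo l))).
by rewrite IH /lcomb; ring.
Qed.

Lemma boundary_sumB M lo k G H :
  boundary_sum M lo k (fun l => G l - H l) = boundary_sum M lo k G - boundary_sum M lo k H.
Proof.
have -> : (fun l => G l - H l) = lcomb 1 (-1) G H.
  by apply: functional_extensionality => l; rewrite /lcomb; ring.
by rewrite boundary_sum_lcomb; ring.
Qed.

(** Every range is nonempty even after its lower bound has been raised, except the last, which may
    be empty with lo = k_0 + 1, where telescoping still holds. *)
Fixpoint admissible (M : nat) (lo : int) (k : point) : Prop :=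
  match M with
  | 0 => True
  | 1 => lo <= k 0%N + 1
  | M'.+1 => lo <= k 0%N /\ admissible M' (k 0%N + 1) (ptail k)
  end.

Lemma admissible_le M lo lo' k : lo' <= lo -> admissible M lo k -> admissible M lo' k.
Proof.
case: M => [|[|M]] //= le; first exact: le_trans.
by move=> [? ?]; split => //; exact: le_trans le _.
Qed.

(** Induction on the number of coordinates, telescoping in the first. The vanishing of W on the
    diagonal reconciles the two possible lower bounds of the second coordinate. *)
Lemma row_sum_boundary M lo k F : admissible M lo k ->
  (forall s k', (s.+1 < M)%N -> k' s = k' s.+1 -> strict_fun s F k' = 0) ->
  row_sum M lo k (difs (iota 0 M) F) = boundary_sum M lo k F.
Proof.
elim: M lo k F => [|M IH] lo k F; first by rewrite row_sum0.
move=> adm van; rewrite row_sumS.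
pose F1 (l : int) : pfun := fun k' => F (pcons (l + 1) k') - F (pcons l k').
have EF l : (fun k' => difs (iota 0 M.+1) F (pcons l k')) = difs (iota 0 M) (F1 l).
  exact: difs_iotaS.
have van1 l s k' : (s.+1 < M)%N -> k' s = k' s.+1 -> strict_fun s (F1 l) k' = 0.
  move=> sM ks; transitivity (strict_fun s.+1 F (pcons (l + 1) k') -
    strict_fun s.+1 F (pcons l k')).
    by rewrite /strict_fun /F1 -!sh_pconsS; ring.
  by rewrite !van ?subrr.
have upS : up M.+1 k = pcons (k 0%N + 1) (up M (ptail k)).
  by apply: functional_extensionality => -[|i].
(* A single coordinate is plain telescoping, under the weaker bound that [admissible] asks of the
   last range. *)
case: M => [|M] in IH adm van van1 EF upS *.
  under eq_bigr => l _ do rewrite EF row_sum0 /=.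
  rewrite (irange_telescope lo (k 0%N) (fun l => F (pcons l pzero))) //= upS.
  congr (F (pcons _ _) - _); exact: functional_extensionality.
case: adm => lok adm.
have le1 : k 0%N <= k 0%N + 1 by lia.
have adm' : admissible M.+1 (k 0%N) (ptail k) := admissible_le M.+1 _ _ (ptail k) le1 adm.
(* Here l is the first coordinate and a the lower bound of the second: a is k_0 for l < k_0, where
   the sum telescopes, and k_0 + 1 for the split-off value l = k_0. *)
pose g (a l : int) := boundary_sum M.+1 a (ptail k) (fun k' => F (pcons l k')).
rewrite irange_rcons // -cats1 big_cat big_seq1 /= eqxx EF IH //; last exact: van1.
rewrite [X in X + _](_ : _ = g (k 0%N) (k 0%N) - g (k 0%N) lo); last first.
  have := irange_telescope lo (k 0%N - 1) (g (k 0%N)); rewrite subrK => <- //.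
  rewrite big_seq [RHS]big_seq; apply: eq_bigr => l; rewrite mem_irange => lk.
  have -> : (l == k 0%N) = false by lia.
  by rewrite EF IH //; [rewrite boundary_sumB | exact: van1].
rewrite boundary_sumB -/(g _ _) -/(g _ _) upS -/(g (k 0%N) lo).
rewrite /g /=; set b := boundary_sum M _ _.
pose P l := F (pcons (k 0%N) (pcons (k 0%N) l)).
pose Q l := F (pcons (k 0%N + 1) (pcons (k 0%N + 1) l)).
pose R l := F (pcons (k 0%N) (pcons (k 0%N + 1) l)).
rewrite -[fun l => F (pcons _ (pcons (k 0%N) l))]/P -/Q -/R.
(* The leading terms of the g's already match; the rest carries P + Q - R, which is W F at a point
   whose first two coordinates are k_0. *)
suff -> : P = lcomb 1 (-1) R Q by rewrite /b boundary_sum_lcomb; lra.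
apply: functional_extensionality => l; rewrite /lcomb /P /Q /R.
have := van 0%N (pcons (k 0%N) (pcons (k 0%N) l)) isT erefl.
rewrite /strict_fun -!sh_pconsS !sh_pcons0; lra.
Qed.

(** Meant for K = (lo, k_0, k_1, ..), whose entries i and i + 1 are the lower and upper bounds of
    coordinate i; the entry K_j is the one left out. *)
Definition cut M j (K : point) : point :=
  fun i => if (i < M)%N then (if (i < j)%N then K i else K i.+1 + 1) else 0.

Lemma boundary_sumE M lo k G :
  boundary_sum M lo k G = \sum_(j < M.+1) (-1) ^+ j * G (cut M j (pcons lo k)).
Proof.
elim: M lo k G => [|M IH] lo k G.
  by rewrite big_ord1 mul1r.
rewrite /= IH [RHS]big_ord_recl mul1r -sumrN; congr (_ + _).
apply: eq_bigr => j _; rewrite /= /bump add1n exprS mulN1r mulNr; congr (- (_ * G _)).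
by apply: functional_extensionality => -[|[|i]].
Qed.

(** * Determinants *)

(** The factors r + 1 - z absorb the sign (-1)^c, so that the leading coefficients in z - z^2 and in
    -z^2 below are positive. *)
Definition shifted_fall (c : nat) (z : rat) : rat := \prod_(0 <= r < c) (r.+1%:R - z).

Lemma shifted_fallS c z : shifted_fall c.+1 z = shifted_fall c z * (c.+1%:R - z).
Proof. exact: big_nat_recr. Qed.

Lemma shifted_fall_sub1 c z : shifted_fall c z * (c.+1%:R - z) = (1 - z) * shifted_fall c (z - 1).
Proof.
rewrite -shifted_fallS /shifted_fall big_nat_recl //; congr (_ * _).
by apply: eq_bigr => r _; rewrite [in LHS]mulrS; ring.
Qed.

Definition even_fun (c : nat) (z : rat) : rat :=
  shifted_fall c z * shifted_fall c (1 - z) / ((2 * c)`!)%:R.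

Definition odd_fun (c : nat) (z : rat) : rat :=
  z * shifted_fall c z * shifted_fall c (- z) / ((2 * c).+1`!)%:R.

Lemma odd_funN c z : odd_fun c (- z) = - odd_fun c z.
Proof. rewrite /odd_fun opprK; ring. Qed.

Lemma fact_neq0 n : (n`!)%:R != 0 :> rat.
Proof. by rewrite pnatr_eq0 -lt0n fact_gt0. Qed.

Lemma odd_fun_dif c z : odd_fun c z - odd_fun c (z - 1) = even_fun c z.
Proof.
rewrite /odd_fun /even_fun factS natrM.
have n1 := fact_neq0 (2 * c); have n2 : ((2 * c).+1)%:R != 0 :> rat by rewrite pnatr_eq0.
have H1 := shifted_fall_sub1 c z; have H2 := shifted_fall_sub1 c (1 - z).
rewrite (_ : 1 - z - 1 = - z) in H2; last by ring.
rewrite (_ : - (z - 1) = 1 - z); last by ring.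
(* Both terms are brought to the common factor (1 - z)..(c - z) times z..(z + c - 1). *)
have -> : z * shifted_fall c z * shifted_fall c (- z) =
    shifted_fall c z * (shifted_fall c (1 - z) * (c.+1%:R - (1 - z))).
  by rewrite H2; ring.
have -> : (z - 1) * shifted_fall c (z - 1) * shifted_fall c (1 - z) =
  - (shifted_fall c z * (c.+1%:R - z)) * shifted_fall c (1 - z) by rewrite H1; ring.
have E : (2 * c).+1%:R = 2 * c%:R + 1 :> rat by rewrite -addn1 natrD natrM.
rewrite E in n2 *; field; apply/andP; split=> //.
Qed.

Lemma even_fun_dif c z : even_fun c.+1 z - even_fun c.+1 (z + 1) = odd_fun c z.
Proof.
rewrite /odd_fun /even_fun mulnS add2n (factS (2 * c).+1) natrM.
have n1 := fact_neq0 (2 * c).+1; have n2 : ((2 * c).+2)%:R != 0 :> rat by rewrite pnatr_eq0.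
rewrite (_ : 1 - (z + 1) = - z); last by ring.
have H1 := shifted_fall_sub1 c (1 - z); rewrite -shifted_fallS in H1.
rewrite (_ : 1 - z - 1 = - z) in H1; last by ring.
have H2 := shifted_fall_sub1 c (z + 1); rewrite -shifted_fallS in H2.
rewrite addrK in H2.
rewrite H1 H2 !shifted_fallS.
have E : (2 * c).+2%:R = 2 * c%:R + 2 :> rat by rewrite -addn2 natrD natrM.
rewrite E in n2 *; rewrite -addn1 natrD; field; apply/andP; split=> //.
Qed.

(** The matrix is the transpose of a triangular coefficient matrix times a Vandermonde matrix. *)
Lemma det_poly m (p : nat -> {poly rat}) (v : nat -> rat) :
  (forall c, (size (p c) <= c.+1)%N) ->
  \det (\matrix_(i < m, c < m) (p c).[v i]) =
  (\prod_(c < m) (p c)`_c) * \prod_(i < m) \prod_(j < m | (i < j)%N) (v j - v i).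
Proof.
move=> sp; pose w : 'rV[rat]_m := \row_i v i.
pose C : 'M[rat]_m := \matrix_(c, r) (p c)`_r.
have -> : \matrix_(i < m, c < m) (p c).[v i] = (C *m Vandermonde m w)^T.
  apply/matrixP => i c; rewrite !mxE (horner_coef_wide _ (leq_trans (sp c) (ltn_ord c))).
  by apply: eq_bigr => r _; rewrite !mxE.
rewrite det_tr det_mulmx det_Vandermonde det_trig; last first.
  by apply/is_trig_mxP => i j ij; rewrite mxE nth_default // (leq_trans (sp i)).
congr (_ * _); first by apply: eq_bigr => c _; rewrite mxE.
by apply: eq_bigr => i _; apply: eq_bigr => j _; rewrite !mxE.
Qed.

(** Monic of degree c whatever the nodes a, which therefore leave no trace in [det_poly]. *)
Definition newton (a : nat -> rat) (c : nat) : {poly rat} := \prod_(0 <= r < c) ('X - (a r)%:P).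

Lemma size_newton a c : size (newton a c) = c.+1.
Proof. by rewrite size_prod_XsubC size_iota subn0. Qed.

Lemma coef_newton a c : (newton a c)`_c = 1.
Proof.
have /monicP := monic_prod_XsubC (index_iota 0 c) predT a.
by rewrite lead_coefE size_newton.
Qed.

Lemma horner_newton a c y : (newton a c).[y] = \prod_(0 <= r < c) (y - a r).
Proof. by rewrite horner_prod; apply: eq_bigr => r _; rewrite hornerXsubC. Qed.

(** The factors r + 1 - z and r + z multiply to r (r + 1) + z - z^2. *)
Lemma even_funE c z :
  even_fun c z = (((2 * c)`!)%:R^-1 *: newton (fun r => - (r * r.+1)%:R) c).[z - z ^+ 2].
Proof.
rewrite hornerZ horner_newton /even_fun mulrC -big_split; congr (_ * _).
by apply: eq_bigr => r _; rewrite /= natrM -!natr1; ring.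
Qed.

(** The factors r + 1 - z and r + 1 + z multiply to (r + 1)^2 - z^2. *)
Lemma odd_funE c z :
  odd_fun c z = z * (((2 * c).+1`!)%:R^-1 *: newton (fun r => - (r.+1 ^ 2)%:R) c).[- z ^+ 2].
Proof.
rewrite hornerZ horner_newton /odd_fun mulrC -mulrA mulrCA -big_split; congr (_ * (_ * _)).
by apply: eq_bigr => r _; rewrite /= natrX -!natr1; ring.
Qed.

(** The factors j - i build j! / (j - n)!, the others (j + n + a)! / (j + a)!. Only n = j is used;
    general n serves the induction. *)
Lemma prod_fact (a j n : nat) : (n <= j)%N ->
  ((j - n)`! * \prod_(i < n) ((j - i) * (j + i + a).+1) * (j + a)`! = j`! * (j + n + a)`!)%N.
Proof.
elim: n => [|n IH] nj; first by rewrite big_ord0 subn0 muln1 addn0.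
rewrite big_ord_recr addnS addSn factS.
have -> : (j`! * ((j + n + a).+1 * (j + n + a)`!) = (j`! * (j + n + a)`!) * (j + n + a).+1)%N by ring.
rewrite -IH; last exact: ltnW.
have -> : (j - n = (j - n.+1).+1)%N by lia.
rewrite factS /=; ring.
Qed.

(** This matches the denominators of the theorem with the leading coefficients: a = 0 for n odd, a =
    1 for n even. *)
Lemma prod_const m (a : nat) :
  \prod_(i < m) \prod_(j < m | (i < j)%N) ((j%:R - i%:R) * (j + i + a.+1)%:R) * \prod_(j < m) (j + a)`!%:R
    = \prod_(j < m) (j`! * (2 * j + a)`!)%:R :> rat.
Proof.
rewrite (exchange_big_dep predT) //= -big_split; apply: eq_bigr => j _ /=.
rewrite mul2n -addnn -prod_fact // subnn mul1n !natrM natr_prod; congr (_ * _).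
pose F i : rat := ((j - i) * (j + i + a).+1)%:R.
transitivity (\prod_(i < m | (i < j)%N) F i); last first.
  exact: esym (big_ord_widen m F (ltnW (ltn_ord j))).
by apply: eq_bigr => i ij; rewrite /F natrM natrB ?(ltnW ij) // addnS.
Qed.

(** Entries may depend on the row index, so that differences can be taken one row at a time. *)
Definition det_fun m (H : nat -> nat -> int -> rat) : pfun :=
  fun K => \det (\matrix_(i < m, c < m) H i c (K i)).

(** With z = x + 1 - k, the Vandermonde difference of z - z^2 between j and i is (k_j - k_i)(2x + 1
    - k_i - k_j). *)
Lemma eval_int_odd_product m x :
  eval_int m (odd_product m x) = det_fun m (fun _ c k => even_fun c (x + 1 - k)%:~R).
Proof.
apply: functional_extensionality => K; rewrite /eval_int /det_fun.
under [in RHS]eq_mx do rewrite even_funE.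
rewrite (det_poly m (fun c => ((2 * c)`!)%:R^-1 *: newton (fun r => - (r * r.+1)%:R) c)
  (fun i => (x + 1 - K i)%:~R - (x + 1 - K i)%:~R ^+ 2)); last first.
  by move=> c; rewrite (leq_trans (size_scale_leq _ _)) // size_newton.
under [X in _ = X * _]eq_bigr => c _ do rewrite coefZ coef_newton mulr1.
rewrite /odd_product rmorph_prod /=.
under eq_bigr => i _.
  rewrite rmorph_prod /=.
  under eq_bigr => j _.
    rewrite mevalZ mevalM !mevalB !mevalXU mevalC.
    over.
  rewrite big_split /=.
  over.
rewrite big_split /=; congr (_ * _); last first.
  apply: eq_bigr => i _; apply: eq_bigr => j _.
  by rewrite !(rmorphB, rmorphD, rmorphM) /=; ring.
under eq_bigr => i _ do rewrite prodfV.
rewrite !prodfV; congr (_^-1).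
have := prod_const m 0; rewrite /= => H.
have n0 : \prod_(j < m) (j + 0)`!%:R != 0 :> rat by apply/prodf_neq0 => j _; exact: fact_neq0.
apply: (mulIf n0); rewrite H -big_split; apply: eq_bigr => j _.
by rewrite /= !addn0 natrM mulrC.
Qed.

(** Pulling z_i = x + 1 - k_i out of each row leaves polynomials in -z^2, whose differences are (k_j
    - k_i)(2x + 2 - k_i - k_j). *)
Lemma eval_int_even_product m x :
  eval_int m (even_product m x) = det_fun m (fun _ c k => odd_fun c (x + 1 - k)%:~R).
Proof.
apply: functional_extensionality => K; rewrite /eval_int /det_fun.
under [in RHS]eq_mx do rewrite odd_funE.
pose p c := ((2 * c).+1`!)%:R^-1 *: newton (fun r => - (r.+1 ^ 2)%:R) c.
pose z i : rat := (x + 1 - K i)%:~R.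
rewrite [X in \det X](_ : _ = diag_mx (\row_(i < m) z i) *m \matrix_(i < m, c < m) (p c).[- z i ^+ 2]); last first.
  by apply/matrixP => i c; rewrite mul_diag_mx !mxE.
rewrite det_mulmx det_diag (det_poly m p (fun i => - z i ^+ 2)); last first.
  by move=> c; rewrite (leq_trans (size_scale_leq _ _)) // size_newton.
under [X in _ = _ * (X * _)]eq_bigr => c _ do rewrite coefZ coef_newton mulr1.
rewrite /even_product mevalM !rmorph_prod /=.
under eq_bigr => i _.
  rewrite rmorph_prod /=.
  under eq_bigr => j _.
    rewrite mevalZ mevalM !mevalB !mevalXU mevalC.
    over.
  rewrite big_split /=.
  over.
rewrite big_split /=.
under [X in _ * X = _]eq_bigr => i _ do rewrite mevalZ mevalB mevalXU mevalC.
rewrite [X in _ * X = _]big_split /=.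
rewrite mulrACA [RHS]mulrCA; congr (_ * _); last first.
  rewrite mulrC; congr (_ * _); last first.
    apply: eq_bigr => i _; apply: eq_bigr => j _.
    by rewrite /z !(rmorphB, rmorphD, rmorphM) /=; ring.
  by apply: eq_bigr => i _; rewrite mxE /z rmorphB.
under eq_bigr => i _ do rewrite prodfV.
rewrite !prodfV -invfM; congr (_^-1).
(* The extra denominators i + 1 turn i! into (i + 1)!, as [prod_const] requires for a = 1. *)
have n0 : \prod_(j < m) (j`!)%:R != 0 :> rat by apply/prodf_neq0 => j _; exact: fact_neq0.
apply: (mulIf n0); rewrite -mulrA -[X in _ * X]big_split -[RHS]big_split /=.
under [RHS]eq_bigr => j _ do rewrite mulrC -natrM -addn1.
rewrite -(prod_const m 1); congr (_ * _); apply: eq_bigr => i _.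
by rewrite -natrM addn1 factS.
Qed.

Lemma det_fun_col0 m H K : (forall i k, H i 0%N k = 1) ->
  det_fun m.+1 H K = \sum_(j < m.+1) (-1) ^+ j *
    det_fun m (fun i c => H (bump j i) c.+1) (del j K).
Proof.
move=> H0; rewrite /det_fun (expand_det_col _ 0); apply: eq_bigr => j _.
rewrite mxE H0 mul1r /cofactor addn0; congr (_ * \det _).
by apply/matrixP => i c; rewrite !mxE.
Qed.

Lemma det_fun_antisym m h : antisym m (det_fun m (fun=> h)).
Proof.
move=> s k sm; rewrite /det_fun.
pose s0 : 'I_m := Ordinal (ltnW sm); pose s1 : 'I_m := Ordinal sm.
have -> : \matrix_(i < m, c < m) h c ((k \o swap_next s) i) =
    row_perm (tperm s0 s1) (\matrix_(i < m, c < m) h c (k i)).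
  apply/matrixP => i c; rewrite !mxE; congr (h _ (k _)).
  rewrite /swap_next; case: tpermP => [->|->|i0 i1] /=.
  - by rewrite eqxx.
  - by rewrite eqn_leq ltnn /= eqxx.
  - case: eqP => [E|_]; first by case: i0; exact: val_inj.
    by case: eqP => [E|//]; case: i1; exact: val_inj.
rewrite row_permE det_mulmx det_perm odd_tperm.
have -> : (s0 != s1) by rewrite -(inj_eq val_inj) /= neq_ltn ltnSn.
by rewrite expr1 mulN1r.
Qed.

(** Variable j occurs in row j only, and the determinant is linear in that row. *)
Lemma dif_det_fun m j H : (j < m)%N ->
  dif j (det_fun m H) = det_fun m (fun i c k => if i == j then H i c (k + 1) - H i c k else H i c k).
Proof.
move=> jm; apply: functional_extensionality => k; rewrite /dif /det_fun.
set X := \matrix_(i, c) H i c (sh j 1 k i); set Y := \matrix_(i, c) H i c (k i).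
rewrite [RHS](@determinant_multilinear _ _ _ X Y (Ordinal jm) 1 (-1)) ?mul1r ?mulN1r //.
- by apply/rowP => c; rewrite !mxE /= /sh eqxx mul1r mulN1r.
- apply/matrixP => i c; rewrite !mxE /sh /=.
  by rewrite eq_sym (negbTE (neq_bump j i)).
- apply/matrixP => i c; rewrite !mxE /=.
  by rewrite eq_sym (negbTE (neq_bump j i)).
Qed.

Lemma difs_det_fun m (h g : nat -> int -> rat) : (forall c k, h c (k + 1) - h c k = g c k) ->
  difs (iota 0 m) (det_fun m (fun=> h)) = det_fun m (fun=> g).
Proof.
move=> hg; have gen s : uniq s -> all (fun j => j < m)%N s ->
    difs s (det_fun m (fun=> h)) = det_fun m (fun i => if i \in s then g else h).
  elim: s => //= j s IH /andP[js us] /andP[jm sm]; rewrite IH // dif_det_fun //.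
  congr det_fun; do 3 (apply: functional_extensionality => ?); rewrite inE.
  by case: eqP => [->|//]; rewrite (negbTE js) hg.
rewrite gen ?iota_uniq //; last by apply/allP => i; rewrite mem_iota.
apply: functional_extensionality => k; rewrite /det_fun; congr (\det _).
by apply/matrixP => i c; rewrite !mxE mem_iota /= ltn_ord.
Qed.

Lemma det_fun_local m H : local m (det_fun m H).
Proof.
move=> k k' kk; rewrite /det_fun; congr (\det _).
by apply/matrixP => i c; rewrite !mxE kk.
Qed.

Lemma det_fun_last_odd m h c0 : (forall c k, h c (c0 - k) = - h c k) ->
  forall k, det_fun m.+1 (fun=> h) (refl m c0 k) = - det_fun m.+1 (fun=> h) k.
Proof.
move=> odd_h k; rewrite /det_fun.
set X := \matrix_(i, c) h c (refl _ _ _ _); set Y := \matrix_(i, c) h c (k i).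
rewrite (@determinant_multilinear _ _ X Y Y ord_max (-1) 0) ?mul0r ?addr0 ?mulN1r //.
- by apply/rowP => c; rewrite !mxE /refl /= eqxx odd_h mulN1r mul0r addr0.
- apply/matrixP => i c; rewrite !mxE /refl /=.
  by rewrite eq_sym (negbTE (neq_bump m i)).
- apply/matrixP => i c; rewrite !mxE /refl /=.
  by rewrite eq_sym (negbTE (neq_bump m i)).
Qed.

Lemma det_funN m h : det_fun m (fun _ c k => - h c k) = scal ((-1) ^+ m) (det_fun m (fun=> h)).
Proof.
apply: functional_extensionality => K; rewrite /det_fun /scal -detZ; congr (\det _).
by apply/matrixP => i c; rewrite !mxE mulN1r.
Qed.

(** * The two summation steps *)

(** The names follow the degrees 2c and 2c + 1 of the entries: [even_det] belongs to odd n and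
    [odd_det] to even n. *)
Definition even_det m (x : int) : pfun := det_fun m (fun _ c k => even_fun c (x + 1 - k)%:~R).
Definition odd_det m (x : int) : pfun := det_fun m (fun _ c k => odd_fun c (x + 1 - k)%:~R).

Lemma even_fun0 z : even_fun 0 z = 1.
Proof. by rewrite /even_fun /shifted_fall !big_geq // !mul1r invr1. Qed.

Lemma row_sum_odd_det M x lo k : admissible M lo k ->
  row_sum M lo k (omega M (odd_det M x)) = omega M.+1 (even_det M.+1 x) (pcons lo k).
Proof.
move=> adm; set K := pcons lo k.
(* Evaluating at k - 1 makes the forward difference of h c equal to [odd_fun] c at x + 1 - k. *)
pose h c (k : int) := even_fun c.+1 (x + 1 - (k - 1))%:~R.
have dh : difs (iota 0 M) (det_fun M (fun=> h)) = odd_det M x.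
  apply: difs_det_fun => c l; rewrite /h addrK -even_fun_dif; congr (_ - even_fun _ _).
  by rewrite -[1 in RHS]/(1%:~R) -intrD; congr (_%:~R); ring.
rewrite -dh [omega M _]pair_ops_difs row_sum_boundary //; last first.
  by move=> s k' sM ks; apply: omega_vanish => //; exact: det_fun_antisym.
pose H := det_fun M (fun _ c k => even_fun c.+1 (x + 1 - k)%:~R).
have -> : even_det M.+1 x = fun K => \sum_(j < M.+1) scal ((-1) ^+ j) (H \o del j) K.
  apply: functional_extensionality => K'; rewrite /even_det det_fun_col0 //.
  by move=> *; exact: even_fun0.
rewrite /omega (pair_ops_sum _ _ (fun j => scal ((-1) ^+ j) (H \o del j))) boundary_sumE.
apply: eq_bigr => j _; rewrite pair_ops_scal /scal; congr (_ * _).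
rewrite -/(omega M.+1 _) omega_del; last by rewrite -ltnS.
(* Translating by -1 turns the cut point into K without K_j and with its first j coordinates lowered
   by 1, exactly what [omega_del] produces. *)
have -> : det_fun M (fun=> h) = H \o translate (fun=> -1) by [].
rewrite pair_ops_translate /=; apply: pair_ops_local; first exact: det_fun_local.
move=> i iM; rewrite /translate /cut iM /lower /translate /del /bump mem_iota add0n /=.
by case: (ltnP i j) => ij; rewrite ?addrK ?add1n ?addr0.
Qed.

Lemma row_sum_even_det M x lo k : admissible M.+1 lo k -> k M = x ->
  row_sum M.+1 lo k (omega M.+1 (even_det M.+1 x)) = omega M.+1 (odd_det M.+1 x) (pcons lo k).
Proof.
move=> adm kM; set K := pcons lo k.
pose h c (k : int) := - odd_fun c (x + 1 - k)%:~R.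
have dh : difs (iota 0 M.+1) (det_fun M.+1 (fun=> h)) = even_det M.+1 x.
  apply: difs_det_fun => c l; rewrite /h -odd_fun_dif opprK addrC; congr (_ - odd_fun _ _).
  by rewrite -[1 in RHS]/(1%:~R) -intrB; congr (_%:~R); ring.
rewrite -dh [omega _ _]pair_ops_difs row_sum_boundary //; last first.
  by move=> s k' sM ks; apply: omega_vanish => //; exact: det_fun_antisym.
(* For j <= M the last coordinate of the cut point is k_M + 1 = x + 1, the centre of the reflection,
   so only j = M + 1 remains. *)
rewrite boundary_sumE big_ord_recr big1 => [|j _]; last first.
  rewrite -/(omega _ _) (omega_odd _ _ (2 * (x + 1))) ?mulr0 //.
    apply: det_fun_last_odd => c l; rewrite /h; congr (- _); rewrite -odd_funN -intrN; congr (odd_fun _ _%:~R); ring.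
  have := ltn_ord j; rewrite ltnS leqNgt => /negbTE jM.
  by rewrite /cut ltnSn jM /K /= kM; ring.
(* The sign of the last boundary term cancels the sign from negating all M + 1 rows. *)
rewrite /= add0r det_funN pair_ops_scal /scal mulrA -exprD addnn -mul2n exprM sqrrN !expr1n mul1r.
apply: pair_ops_local; first exact: det_fun_local.
by move=> i iM; rewrite /cut iM.
Qed.

(** * Counting triangles *)

(** Plain indices avoid dependent types; the value outside the triangle is 0. *)
Definition entry n (a : tri_array n) (i j : nat) : int :=
  if (insub i : option 'I_n) is Some i' then
    if (insub j : option 'I_(uphalf i'.+1)) is Some j'
    then a (Tagged (fun i : 'I_n => 'I_(uphalf i.+1)) j') else 0
  else 0.

Definition tri_of n (h : nat -> nat -> int) : tri_array n :=
  [ffun c : cell n => h (row_of c) (col_of c)].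

Lemma entry_cell n (a : tri_array n) (c : cell n) : entry n a (row_of c) (col_of c) = a c.
Proof. by case: c => i j; rewrite /entry /row_of /col_of /= valK /= valK. Qed.

Lemma cellP n i j : (i < n)%N -> (j < uphalf i.+1)%N ->
  exists c : cell n, row_of c = i /\ col_of c = j.
Proof.
move=> lin lju; pose i' := Ordinal lin; pose j' : 'I_(uphalf i'.+1) := Ordinal lju.
by exists (Tagged (fun i : 'I_n => 'I_(uphalf i.+1)) j').
Qed.

Lemma row_lt n (c : cell n) : (row_of c < n)%N.
Proof. exact: ltn_ord. Qed.

Lemma col_lt n (c : cell n) : (col_of c < uphalf (row_of c).+1)%N.
Proof. exact: ltn_ord. Qed.

Lemma entry_tri_of n h i j : (i < n)%N -> (j < uphalf i.+1)%N -> entry n (tri_of n h) i j = h i j.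
Proof. by move=> /cellP + lju => /(_ _ lju)[c [<- <-]]; rewrite entry_cell ffunE. Qed.

Lemma tri_arrayP n (a b : tri_array n) :
  (forall i j, (i < n)%N -> (j < uphalf i.+1)%N -> entry n a i j = entry n b i j) -> a = b.
Proof. by move=> E; apply/ffunP => c; rewrite -!entry_cell E ?row_lt ?col_lt. Qed.

Definition add_row n (K : point) (a : tri_array n) : tri_array n.+1 :=
  tri_of n.+1 (fun i j => if (i < n)%N then entry n a i j else K j).

(** When two consecutive rows have equal length, the last entry of the upper one has no lower right
    neighbour, and x bounds it instead. *)
Definition next_bounds (x : int) m (K : point) : point :=
  fun i => if (i.+1 < m)%N then K i.+1 else x.

Fixpoint triangles (x : int) (n : nat) (K : point) : seq (tri_array n) :=
  match n return seq (tri_array n) with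
  | 0 => [:: tri_of 0 (fun _ _ => 0)]
  | n'.+1 => [seq add_row n' K a | r <- rows (uphalf n') (K 0%N) (next_bounds x (uphalf n'.+1) K),
                               a <- triangles x n' (pad r)]
  end.

Record good (n : nat) (x : int) (K : point) (h : nat -> nat -> int) : Prop := Good {
  good_down : forall i j, (i.+1 < n)%N -> (j < uphalf i.+1)%N -> h i.+1 j <= h i j;
  good_up : forall i j, (i.+1 < n)%N -> (j < uphalf i.+1)%N -> (j.+1 < uphalf i.+2)%N ->
    h i j <= h i.+1 j.+1;
  good_row : forall i j, (i < n)%N -> (j.+1 < uphalf i.+1)%N -> h i j < h i j.+1;
  good_bottom : forall i j, i.+1 = n -> (j < uphalf n)%N -> h i j = K j;
  good_le : forall i j, (i < n)%N -> (j < uphalf i.+1)%N -> h i j <= x }.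

Lemma leq_uphalfS n : (uphalf n <= uphalf n.+1)%N.
Proof. by lia. Qed.

Lemma good_eq n x K h h' :
  (forall i j, (i < n)%N -> (j < uphalf i.+1)%N -> h i j = h' i j) ->
  good n x K h -> good n x K h'.
Proof.
move=> E [g1 g2 g3 g4 g5]; split=> i j.
- by move=> ? ?; rewrite -!E; auto; lia.
- by move=> ? ? ?; rewrite -!E; auto; lia.
- by move=> ? ?; rewrite -!E; auto; lia.
- by move=> ? ?; rewrite -E; auto; lia.
- by move=> ? ?; rewrite -E; auto.
Qed.

(** Row [n.-1] lies just above the bottom row; for n = 0 all conditions on it are void because
    [uphalf 0] is 0. *)
Lemma goodS n x K h :
  (forall i, (i.+1 < uphalf n.+1)%N -> K i < K i.+1) ->
  (forall i, (i < uphalf n.+1)%N -> K i <= x) ->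
  good n.+1 x K h <->
  [/\ good n x (h n.-1) h,
      forall j, (j < uphalf n.+1)%N -> h n j = K j,
      forall j, (j < uphalf n)%N -> K j <= h n.-1 j <= next_bounds x (uphalf n.+1) K j
    & forall j, (j.+1 < uphalf n)%N -> h n.-1 j < h n.-1 j.+1].
Proof.
move=> Kinc Kle; split=> [[g1 g2 g3 g4 g5]|[[g1 g2 g3 g4 g5] Kb bd inc]].
- split=> [|j ju|j ju|j ju]; last 3 first.
  + by rewrite g4.
  + case: n => [//|n] /= in Kinc Kle g1 g2 g3 g4 g5 ju *.
    rewrite -(g4 n.+1) //; last by lia.
    rewrite g1 //= /next_bounds; case: ltnP => ju'; last by apply: g5 => //; lia.
    by rewrite -(g4 n.+1) //; exact: g2.
  + by case: n => [//|n] /= in Kinc Kle g1 g2 g3 g4 g5 ju *; apply: g3 => //; lia.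
  split=> i j.
  + by move=> *; apply: g1; lia.
  + by move=> *; apply: g2; lia.
  + by move=> *; apply: g3; lia.
  + by move=> <-.
  + by move=> *; apply: g5; lia.
- split=> i j.
  + move=> lin ju; case: (ltngtP i.+1 n) => [lin'|lin'|E]; [exact: g1|by lia|].
    by subst n; rewrite Kb; [case/andP: (bd j ju) | lia].
  + move=> lin ju ju'; case: (ltngtP i.+1 n) => [lin'|lin'|E]; [exact: g2|by lia|].
    by subst n; rewrite Kb //; case/andP: (bd j ju); rewrite /next_bounds ju'.
  + move=> lin ju; case: (ltngtP i n) => [lin'|lin'|E]; [exact: g3|by lia|].
    by subst n; rewrite !Kb //; [exact: Kinc | lia].
  + by move=> [->] ju; exact: Kb.
  + move=> lin ju; case: (ltngtP i n) => [lin'|lin'|E]; [exact: g5|by lia|].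
    by subst n; rewrite Kb //; exact: Kle.
Qed.

Lemma entry_add_row_lt n K a i j : (i < n)%N -> (j < uphalf i.+1)%N ->
  entry n.+1 (add_row n K a) i j = entry n a i j.
Proof. by move=> lin ju; rewrite entry_tri_of ?lin // ltnW. Qed.

Lemma entry_add_row_bottom n K a j : (j < uphalf n.+1)%N -> entry n.+1 (add_row n K a) n j = K j.
Proof. by move=> ju; rewrite entry_tri_of // ltnn. Qed.

Lemma mem_triangles x n K a :
  (forall i, (i.+1 < uphalf n)%N -> K i < K i.+1) ->
  (forall i, (i < uphalf n)%N -> K i <= x) ->
  reflect (good n x K (entry n a)) (a \in triangles x n K).
Proof.
elim: n K a => [|n IH] K a Kinc Kle.
  rewrite [triangles _ _ _]/= inE; apply: (iffP eqP) => _; first by split.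
  exact: tri_arrayP.
have mr r : r \in rows (uphalf n) (K 0%N) (next_bounds x (uphalf n.+1) K) <->
  [/\ size r = uphalf n,
      forall j, (j < uphalf n)%N -> K j <= r`_j <= next_bounds x (uphalf n.+1) K j
    & forall j, (j.+1 < uphalf n)%N -> r`_j < r`_j.+1].
  have E j : (j < uphalf n)%N -> pcons (K 0%N) (next_bounds x (uphalf n.+1) K) j = K j.
    by case: j => // j ju; rewrite /= /next_bounds (leq_trans ju (leq_uphalfS n)).
  split=> [/mem_rows|] [sz bd inc]; last apply/mem_rows; split=> // j ju; have := bd j ju.
    by rewrite E.
  by rewrite E.
have padH r : r \in rows (uphalf n) (K 0%N) (next_bounds x (uphalf n.+1) K) ->
    (forall i, (i.+1 < uphalf n)%N -> pad r i < pad r i.+1) /\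
    (forall i, (i < uphalf n)%N -> pad r i <= x).
  move=> /mr[_ bd inc]; split=> // i iu; have /andP[_ /le_trans] := bd i iu; apply.
  by rewrite /next_bounds; case: ifP => // /Kle.
apply: (iffP allpairsPdep) => [[r [b [rr + ->]]]|/goodS[//|//|g Kb bd inc]].
  have [ri rx] := padH r rr; move=> /(IH _ _ ri rx) gb; have [sz bd inc] := iffLR (mr r) rr.
  have rb j : (j < uphalf n)%N -> entry n.+1 (add_row n K b) n.-1 j = r`_j.
    move=> ju; have n0 : (0 < n)%N by case: n ju {gb IH bd inc sz mr rr a Kinc Kle ri rx padH b}.
    by rewrite entry_add_row_lt ?prednK // (good_bottom _ _ _ _ gb) // prednK.
  apply/goodS => //; split=> [|j ju|j ju|j ju]; last 3 first.
  - exact: entry_add_row_bottom.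
  - by rewrite rb // bd.
  - by rewrite !rb ?inc // ltnW.
  have {}gb : good n x (pad r) (entry n.+1 (add_row n K b)).
    by apply: good_eq gb => i j lin ju; rewrite entry_add_row_lt.
  case: gb => g1 g2 g3 g4 g5; split=> // i j E ju.
  by have -> : i = n.-1 by lia.
pose r := mkseq (entry n.+1 a n.-1) (uphalf n); pose b := tri_of n (entry n.+1 a).
have rr : r \in rows (uphalf n) (K 0%N) (next_bounds x (uphalf n.+1) K).
  apply/mr; split=> [|j ju|j ju]; rewrite ?size_mkseq // !nth_mkseq //; last exact: ltnW.
  - exact: bd.
  - exact: inc.
exists r, b; split=> //.
  have [ri rx] := padH r rr; apply/IH => //.
  apply: (good_eq n x _ (entry n.+1 a)) => [i j lin ju|]; first by rewrite entry_tri_of.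
  case: g => g1 g2 g3 g4 g5; split=> // i j E ju.
  by rewrite (g4 _ _ E ju) /pad nth_mkseq.
apply: tri_arrayP => i j lin ju; rewrite entry_tri_of //; case: ltnP => lin'; first by rewrite entry_tri_of.
have En : i = n by lia.
by rewrite En Kb // -En.
Qed.

Lemma triangles_bottom x n K a i j : a \in triangles x n K -> i.+1 = n -> (j < uphalf n)%N ->
  entry n a i j = K j.
Proof.
by case: n a => // n a /allpairsPdep[r [b [_ _ ->]]] [->] ju; rewrite entry_add_row_bottom.
Qed.

(** A triangle determines its upper part, and that part determines the chosen row r as its bottom
    row. *)
Lemma uniq_triangles x n K : uniq (triangles x n K).
Proof.
elim: n K => // n IH K; apply: allpairs_uniq_dep; first exact: uniq_rows.
  by move=> *; exact: IH.
move=> _ _ /allpairsPdep[r [a [rr ar ->]]] /allpairsPdep[s [b [ss bs ->]]] /= eq_ext.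
have ab : a = b.
  by apply: tri_arrayP => i j lin ju; rewrite -(entry_add_row_lt n K) // eq_ext entry_add_row_lt.
have [sr _ _] := elimT (mem_rows _ _ _ _) rr; have [sz _ _] := elimT (mem_rows _ _ _ _) ss.
suff -> : r = s by rewrite ab.
apply: (@eq_from_nth _ 0); rewrite ?sr ?sz // => j ju.
have En : n.-1.+1 = n by case: n ju {IH rr ar ss bs eq_ext sr sz a b ab}.
by rewrite -[LHS](triangles_bottom _ _ _ _ _ _ ar En ju) ab (triangles_bottom _ _ _ _ _ _ bs En ju).
Qed.

Lemma size_trianglesS x n K :
  (size (triangles x n.+1 K))%:R =
  row_sum (uphalf n) (K 0%N) (next_bounds x (uphalf n.+1) K) (fun l => (size (triangles x n l))%:R).
Proof.
by rewrite /row_sum [triangles x n.+1 K]/= size_allpairs_dep sumnE big_map natr_sum.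
Qed.

(** The last comparison is weak because the last upper bound may be x, and an entry of the bottom
    row may equal x too. *)
Lemma admissibleI M lo k :
  (M = 1%N -> lo <= k 0%N + 1) -> ((1 < M)%N -> lo <= k 0%N) ->
  (forall i, (i.+2 < M)%N -> k i < k i.+1) -> (forall i, i.+2 = M -> k i <= k i.+1) ->
  admissible M lo k.
Proof.
elim: M lo k => [|[|M] IH] lo k H1 H2 H3 H4 //=; first exact: H1.
split; first exact: H2.
apply: IH => [[E]|M0|i iM|i E]; rewrite /ptail.
- by rewrite lerD2r; apply: H4; rewrite E.
- by have := H3 0%N M0; lia.
- exact: H3.
- by apply: H4; rewrite E.
Qed.

Lemma size_triangles x n K :
  (forall i, (i.+1 < uphalf n)%N -> K i < K i.+1) ->
  (forall i, (i < uphalf n)%N -> K i <= x) ->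
  (size (triangles x n K))%:R =
    omega (uphalf n) ((if odd n then even_det else odd_det) (uphalf n) x) K.
Proof.
(* With no rows there is one empty array, and the empty determinant is 1. *)
elim: n K => [|n IH] K Kinc Kle; first by rewrite /omega /= /odd_det /det_fun det_mx00.
set kk := next_bounds x (uphalf n.+1) K.
have Kkk i : (i < uphalf n.+1)%N -> pcons (K 0%N) kk i = K i.
  by case: i => // i iu; rewrite /= /kk /next_bounds iu.
have -> : (size (triangles x n.+1 K))%:R = row_sum (uphalf n) (K 0%N) kk
    (omega (uphalf n) ((if odd n then even_det else odd_det) (uphalf n) x)).
  rewrite size_trianglesS; apply: eq_big_seq => r /mem_rows[sz bd inc].
  apply: IH => // i iu; have /andP[_ /le_trans] := bd i iu; apply.
  by rewrite /kk /next_bounds; case: ifP => // /Kle.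
have adm : admissible (uphalf n) (K 0%N) kk.
  apply: admissibleI => [E|E|i iu|i E]; rewrite /kk /next_bounds.
  - case: ifP => [/Kinc|_]; first by lia.
    by rewrite (le_trans (Kle 0%N _)) ?lerDl //; lia.
  - by rewrite ifT; [apply/ltW/Kinc; lia|lia].
  - by rewrite !ifT; [apply: Kinc; lia|lia|lia].
  - rewrite ifT; last by lia.
    by case: ifP => [/Kinc/ltW //|_]; apply: Kle; lia.
(* For n odd the new bottom row is as long as the one above it; for n even it is longer by one. *)
case: (boolP (odd n)) => on.
  have [M EM] : exists M, uphalf n = M.+1 by exists (uphalf n).-1; lia.
  have EM' : uphalf n.+1 = M.+1 by lia.
  rewrite EM in adm *; rewrite row_sum_even_det //; last by rewrite /kk /next_bounds EM' ltnn.
  rewrite EM' /= on; apply: pair_ops_local; first exact: det_fun_local.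
  by move=> i; rewrite -EM'; exact: Kkk.
rewrite row_sum_odd_det // (_ : uphalf n.+1 = (uphalf n).+1); last by lia.
rewrite /= on; apply: pair_ops_local; first exact: det_fun_local.
by move=> i iu; apply: Kkk; lia.
Qed.

Lemma goodP n x (K : point) (k : 'I_(uphalf n) -> int) (a : tri_array n) :
  (forall i : 'I_(uphalf n), K i = k i) ->
  good n x K (entry n a) <-> [/\ halved_monotone a, has_bottom_row a k & entries_le a x].
Proof.
move=> Kk; split=> [[g1 g2 g3 g4 g5]|[mono bot le]].
- split=> [s t|c j rc cc|c].
  + rewrite -!entry_cell; have := row_lt n t; have := col_lt n t; have := col_lt n s.
    have := row_lt n s; move: (row_of s) (row_of t) (col_of s) (col_of t) => i i' j j'.
    move=> lin ju ju' lin'.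
    split=> [E E'|E E'|E E']; subst i' j'; [exact: g1|exact: g2|exact: g3].
  + rewrite -entry_cell cc -Kk; apply: g4 => //; exact: ltn_ord.
  + by rewrite -entry_cell; apply: g5; [exact: row_lt|exact: col_lt].
have getE i j : (i < n)%N -> (j < uphalf i.+1)%N ->
    exists2 c : cell n, row_of c = i /\ col_of c = j & entry n a i j = a c.
  by move=> /cellP + ju => /(_ j ju)[c [<- <-]]; exists c; rewrite ?entry_cell.
split=> i j.
- move=> lin ju; have [s [rs cs] ->] := getE i j (ltnW lin) ju.
  have [t [rt ct] ->] := getE i.+1 j lin (leq_trans ju (leq_uphalfS _)).
  by have [H _ _] := mono s t; rewrite H ?rs ?rt ?ct.
- move=> lin ju ju'; have [s [rs cs] ->] := getE i j (ltnW lin) ju.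
  have [t [rt ct] ->] := getE i.+1 j.+1 lin ju'.
  by have [_ H _] := mono s t; rewrite H ?rs ?rt ?ct ?cs.
- move=> lin ju; have [s [rs cs] ->] := getE i j lin (ltnW ju).
  have [t [rt ct] ->] := getE i j.+1 lin ju.
  by have [_ _ H] := mono s t; rewrite H ?rs ?rt ?ct ?cs.
- move=> E ju; have [||c [rc cc] ->] := getE i j; rewrite ?E // -?E //.
  by rewrite (bot c (Ordinal ju)) ?rc // -Kk.
- by move=> lin ju; have [c _ ->] := getE i j lin ju; exact: le.
Qed.

Theorem theorem1 (n : nat) (x : int) (k : 'I_(uphalf n) -> int) :
  (1 <= n)%N ->
  (forall i j : 'I_(uphalf n), (i < j)%N -> k i < k j) ->
  (forall i : 'I_(uphalf n), k i <= x) ->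
  exists S : {fset tri_array n},
    (forall a : tri_array n,
       a \in S <->
       [/\ halved_monotone a, has_bottom_row a k & entries_le a x]) /\
    (#|` S|%fset)%:R =
      (if odd n
       then (triangle_op (odd_product (uphalf n) x)).@[fun i => (k i)%:~R]
       else (triangle_op (even_product (uphalf n) x)).@[fun i => (k i)%:~R]).
Proof.
move=> _ kinc kle.
pose K : point := fun i => oapp k 0 (insub i).
have Kk (i : 'I_(uphalf n)) : K i = k i by rewrite /K valK.
have Kinc i : (i.+1 < uphalf n)%N -> K i < K i.+1.
  by move=> iu; rewrite (Kk (Ordinal (ltnW iu))) (Kk (Ordinal iu)) kinc.
have Kle i : (i < uphalf n)%N -> K i <= x by move=> iu; rewrite (Kk (Ordinal iu)).
exists [fset a in triangles x n K]%fset; split=> [a|].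
  rewrite -(goodP n x K k a Kk) in_fset /=.
  by split=> /mem_triangles; apply.
rewrite card_fseq undup_id ?uniq_triangles // size_triangles //.
have evK p : eval_int (uphalf n) p K = p.@[fun i => (k i)%:~R].
  by apply: meval_eq => i; rewrite Kk.
by case: (odd n); rewrite -evK eval_int_triangle_op ?eval_int_odd_product ?eval_int_even_product.
Qed.
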